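(* For every positive integer $n$, the complete graph $K_n$ satisfies $\mu(K_n)=n$.
   Context: Let $G$ be a finite simple graph on the vertex set $\{1,\dots,n\}$ and let $\Gamma$ be a finite set of colors. A strategy for vertex $i$ is a function $F_i:\Gamma^n\to\Gamma$ whose value $F_i(x_1,\dots,x_n)$ depends only on those coordinates $x_j$ for which $j$ is adjacent to $i$ in $G$. A system of strategies $(F_1,\dots,F_n)$ is winning if for every $(x_1,\dots,x_n)\in\Gamma^n$ there is at least one $i$ with $F_i(x_1,\dots,x_n)=x_i$. The hat chromatic number $\mu(G)$ is the largest integer $k=|\Gamma|$ for which a winning system of strategies exists on $G$. *)

(* Defs.v *)
From mathcomp Require Import all_boot.

Set Implicit Arguments.
Unset Strict Implicit.
Unset Printing Implicit Defensive.

(* The vertices 1, ..., n are represented by 'I_n = {0, ..., n - 1}. *)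
Record sgraph (n : nat) := SGraph {
  adj : rel 'I_n;
  adj_sym : symmetric adj;
  adj_irr : irreflexive adj
}.

Definition complete_adj (n : nat) : rel 'I_n := fun i j => i != j.

Lemma complete_adj_sym (n : nat) : symmetric (@complete_adj n).
Proof. by move=> i j; rewrite /complete_adj eq_sym. Qed.

Lemma complete_adj_irr (n : nat) : irreflexive (@complete_adj n).
Proof. by move=> i; rewrite /complete_adj eqxx. Qed.

Definition complete_graph (n : nat) : sgraph n :=
  SGraph (@complete_adj_sym n) (@complete_adj_irr n).

Definition is_strategy (n : nat) (G : sgraph n) (Gamma : finType) (i : 'I_n)
    (f : {ffun 'I_n -> Gamma} -> Gamma) : Prop :=
  forall x y : {ffun 'I_n -> Gamma},
    (forall j : 'I_n, adj G j i -> x j = y j) -> f x = f y.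

Definition winning (n : nat) (Gamma : finType)
    (F : 'I_n -> {ffun 'I_n -> Gamma} -> Gamma) : Prop :=
  forall x : {ffun 'I_n -> Gamma}, exists i : 'I_n, F i x = x i.

Definition winnable (n : nat) (G : sgraph n) (k : nat) : Prop :=
  exists Gamma : finType, #|Gamma| = k /\
    exists F : 'I_n -> {ffun 'I_n -> Gamma} -> Gamma,
      (forall i : 'I_n, is_strategy G i (F i)) /\ winning F.

(* "mu(G) = k", as a relation: it asserts both that the maximum exists and that
   it is k. *)
Definition is_hat_chromatic_number (n : nat) (G : sgraph n) (k : nat) : Prop :=
  winnable G k /\ forall m : nat, winnable G m -> m <= k.

Lemma is_hat_chromatic_number_inj (n : nat) (G : sgraph n) (k l : nat) :
  is_hat_chromatic_number G k -> is_hat_chromatic_number G l -> k = l.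
Proof.
by move=> [Wk maxk] [Wl maxl]; apply/eqP; rewrite eqn_leq maxl // maxk.
Qed.

(* Main.v *)
Require Import Defs.
From mathcomp Require Import all_boot.
From mathcomp Require Import all_algebra.

(** With the colors identified with Z/n, vertex [i] bets that the total of all
    colors is [i]; exactly one vertex is right. Conversely, recoloring vertex [i]
    does not change its guess, so it is right for at most a fraction [1/m] of the
    colorings with [m] colors, and [n < m] vertices cannot cover them all. *)

Lemma card_correct_guesses (n : nat) (G : sgraph n) (Gamma : finType) (i : 'I_n)
    (f : {ffun 'I_n -> Gamma} -> Gamma) :
  is_strategy G i f ->
  #|[set x | f x == x i]| * #|Gamma| <= #|{ffun 'I_n -> Gamma}|.
Proof.
move=> f_strat; rewrite -cardsT -cardsX.
(* Injective on pairs [(x, c)] with [f x = x i]: the result shows [c] at [i] and [x] elsewhere, and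
   the overwritten [x i] is recovered as [f x], which depends only on the colors off [i]. *)
pose recolor (p : {ffun 'I_n -> Gamma} * Gamma) :=
  [ffun j => if j == i then p.2 else p.1 j].
rewrite -(@card_in_imset _ _ recolor) ?max_card //.
move=> [x c] [y d]; rewrite !inE !andbT /= => /eqP fx /eqP fy /ffunP exy.
have eq_cd : c = d by move: (exy i); rewrite !ffunE eqxx.
have eq_off j : j != i -> x j = y j.
  by move=> /negPf ji; move: (exy j); rewrite !ffunE ji.
suff -> : x = y by rewrite eq_cd.
apply/ffunP => j; have [->|/eq_off //] := eqVneq j i.
rewrite -fx -fy; apply: f_strat => k adj_ki; apply: eq_off.
by apply: contraTneq adj_ki => ->; rewrite adj_irr.
Qed.

Lemma winnable_leq (n : nat) (G : sgraph n) (m : nat) : winnable G m -> m <= n.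
Proof.
case=> Gamma [<- [F [F_strat F_win]]].
(* Having at least one color makes the number of colorings positive, so that it can be cancelled
   below. *)
have [->//|Gamma_gt0] := posnP #|Gamma|.
have cover : #|{ffun 'I_n -> Gamma}| <= \sum_(i < n) #|[set x | F i x == x i]|.
  rewrite -cardsT.
  have -> : [set: {ffun 'I_n -> Gamma}] = \bigcup_(i < n) [set x | F i x == x i].
    apply/setP=> x; rewrite inE; apply/esym/bigcupP.
    by have [i /eqP Fix] := F_win x; exists i; rewrite ?inE.
  elim/big_rec2: _ => [|i N A _ le_AN]; first by rewrite cards0.
  by rewrite (leq_trans (leq_card_setU _ _)) // leq_add2l.
have colorings_gt0 : 0 < #|{ffun 'I_n -> Gamma}|.
  by rewrite card_ffun expn_gt0 Gamma_gt0.
rewrite -(leq_pmul2l colorings_gt0) (leq_trans (leq_mul cover (leqnn _))) //.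
rewrite big_distrl /= [leqRHS]mulnC.
have -> : n * #|{ffun 'I_n -> Gamma}| = \sum_(i < n) #|{ffun 'I_n -> Gamma}|.
  by rewrite sum_nat_const card_ord.
by apply: leq_sum => i _; apply: card_correct_guesses (F_strat i).
Qed.

Lemma winnable_complete_graph (n : nat) :
  0 < n -> winnable (complete_graph n) n.
Proof.
case: n => // n _; exists 'I_n.+1; split; first exact: card_ord.
(* Arithmetic is modulo [n.+1]; this guess is the only color at [i] that makes the total equal to
   [i]. *)
exists (fun i x => (i - \sum_(j | j != i) x j)%R); split=> [i x y eq_xy | x].
  by congr (_ - _)%R; apply: eq_bigr => j /eq_xy.
(* The total color, read as a vertex, names the one that guesses right. *)
exists (\sum_j x j)%R.
by rewrite [X in (X - _)%R](bigD1 (\sum_j x j)%R) //= GRing.addrK.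
Qed.

Theorem theorem1 (n : nat) (n_gt0 : 0 < n) :
  is_hat_chromatic_number (complete_graph n) n.
Proof.
split; first exact: winnable_complete_graph.
by move=> m; apply: winnable_leq.
Qed.
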